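(* Let $\{a_{ij}\}_{j\in\mathcal J_i}$ be a finite nonempty family of nonzero vectors in $\mathbb R^2$, and let $G$ be the largest angular gap between consecutive directions (including wrap-around). If $G>\pi$, then all the vectors lie within the complementary arc of width $2\pi-G<\pi$, and the cone they generate is generated by the two extreme rays of that arc, namely the two directions $\tilde a_{i1},\tilde a_{i2}$ of the family adjacent to the largest gap. Retaining these two directions gives $$a_{ij}\in\operatorname{cone}\{\tilde a_{i1},\tilde a_{i2}\}\qquad\text{for every } j\in\mathcal J_i,$$ so $K=2$ retained directions suffice.
   Context: $\operatorname{cone}\{v_1,\dots,v_K\}=\{\sum_k\mu_kv_k:\mu_k\ge0\}$. Angular gaps: write the polar angles of the vectors in sorted order $\theta_1\le\cdots\le\theta_m$ in $[0,2\pi)$; the gaps are $\theta_{l+1}-\theta_l$ for $1\le l<m$ and the wrap-around gap $\theta_1+2\pi-\theta_m$; $G$ is the largest of these, and the two directions adjacent to the largest gap are those at its two ends (they may coincide when all vectors have the same direction). *)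

(* Defs.v *)
From mathcomp Require Import all_boot all_order all_algebra.
From mathcomp Require Import all_classical all_reals all_analysis.

Set Implicit Arguments.
Unset Strict Implicit.
Unset Printing Implicit Defensive.

Import Order.TTheory GRing.Theory Num.Theory.
Local Open Scope classical_set_scope.
Local Open Scope ring_scope.

Definition cone (R : realType) (n : nat) (vs : seq 'rV[R]_n) : set 'rV[R]_n :=
  [set x | exists2 mu : 'I_(size vs) -> R,
     (forall k, 0 <= mu k) & x = \sum_k mu k *: vs`_k].

Definition unit_dir (R : realType) (t : R) : 'rV[R]_2 :=
  \row_(k < 2) (if k == 0 then cos t else sin t).

(* The apex is excluded. *)
Definition open_ray (R : realType) (t : R) : set 'rV[R]_2 :=
  [set r *: unit_dir t | r in [set r : R | 0 < r]].

(* The vectors whose direction lies on the closed counterclockwise arc of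
   width w starting at angle s; s + w may exceed 2 * pi. *)
Definition arc_sector (R : realType) (s w : R) : set 'rV[R]_2 :=
  [set v | exists2 t, s <= t <= s + w & open_ray t v].

(* The set below is a singleton when v != 0 and is empty when v = 0, in which
   case the value 0 is junk. *)
Definition polar_angle (R : realType) (v : 'rV[R]_2) : R :=
  xget 0 [set t : R | 0 <= t < 2 * pi /\ open_ray t v].

(* One entry per member of the family, so equal angles are repeated. *)
Definition sorted_angles (R : realType) (J : finType) (a : J -> 'rV[R]_2) :
    seq R :=
  sort <=%R [seq polar_angle (a j) | j : J].

(* Indices start at 0: for l.+1 < m = size th this is the gap following th`_l,
   and the index l = m.-1 gives the wrap-around gap. *)
Definition gap (R : realType) (th : seq R) (l : nat) : R :=
  if (l.+1 < size th)%N then th`_l.+1 - th`_l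
  else th`_0 + 2 * pi - th`_(size th).-1.

(* For a sorted sequence of angles in [0, 2 * pi) all gaps are nonnegative, so
   the default value 0 does not affect the maximum. *)
Definition largest_gap (R : realType) (J : finType) (a : J -> 'rV[R]_2) : R :=
  let th := sorted_angles a in
  \big[Order.max/0]_(l < size th) gap th l.

(* The members a j1 and a j2 of the family lie in the directions at the start
   and at the end, respectively, of a gap of maximal size (going
   counterclockwise). The successor of the last index is 0. *)
Definition adjacent_to_largest_gap (R : realType) (J : finType)
    (a : J -> 'rV[R]_2) (j1 j2 : J) : Prop :=
  let th := sorted_angles a in
  exists l : 'I_(size th),
    [/\ gap th l = largest_gap a,
        polar_angle (a j1) = th`_l
      & polar_angle (a j2) = th`_(l.+1 %% size th)].

(* Main.v *)
(** The unit vector at angle [t] in the arc [[s, s + w]], [0 < w < pi], is the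
    nonnegative combination of the two ends with coefficients
    [sin (s + w - t) / sin w] and [sin (t - s) / sin w]. Hence it is enough that
    cutting the circle at the largest gap places all the angles, up to one full
    turn, in an arc of width [2 * pi - G < pi]. *)

Require Import Defs.
From mathcomp Require Import all_boot all_order all_algebra.
From mathcomp Require Import all_classical all_reals all_analysis.
From mathcomp Require Import ring lra.

Set Implicit Arguments.
Unset Strict Implicit.
Unset Printing Implicit Defensive.

Import Order.TTheory GRing.Theory Num.Theory.
Local Open Scope classical_set_scope.
Local Open Scope ring_scope.

Section Cone.
Variables (R : realType) (n : nat).
Implicit Types (vs ws : seq 'rV[R]_n) (x y : 'rV[R]_n).

Lemma cone0 vs : cone vs 0.
Proof. by exists (fun=> 0) => //; rewrite big1 // => k _; rewrite scale0r. Qed.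

Lemma coneD vs x y : cone vs x -> cone vs y -> cone vs (x + y).
Proof.
move=> [mu mu_ge0 ->] [nu nu_ge0 ->].
exists (fun k => mu k + nu k) => [k|]; first by rewrite addr_ge0.
by rewrite -big_split; apply: eq_bigr => k _; rewrite scalerDl.
Qed.

Lemma coneZ vs r x : 0 <= r -> cone vs x -> cone vs (r *: x).
Proof.
move=> r_ge0 [mu mu_ge0 ->].
exists (fun k => r * mu k) => [k|]; first by rewrite mulr_ge0.
by rewrite scaler_sumr; apply: eq_bigr => k _; rewrite scalerA.
Qed.

Lemma mem_cone vs x : x \in vs -> cone vs x.
Proof.
move=> x_vs; have i_lt : (index x vs < size vs)%N by rewrite index_mem.
exists (fun k => (k == Ordinal i_lt)%:R) => [k|]; first exact: ler0n.
rewrite (bigD1 (Ordinal i_lt)) //= eqxx scale1r nth_index // big1 ?addr0 //.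
by move=> k /negPf ->; rewrite scale0r.
Qed.

(** Cones are closed under sums and nonnegative multiples, so only the generators need checking. *)
Lemma cone_sub vs ws :
  (forall v, v \in vs -> cone ws v) -> cone vs `<=` cone ws.
Proof.
move=> vs_ws _ [mu mu_ge0 ->].
elim/big_ind: _ => [|x y|k _]; [exact: cone0 | exact: coneD |].
by apply: coneZ => //; apply: vs_ws; rewrite mem_nth.
Qed.

End Cone.

Section Angles.
Variable R : realType.
Implicit Types (s t w : R) (u v : 'rV[R]_2).

Lemma unit_dirD2pi t : unit_dir (t + 2 * pi) = unit_dir t.
Proof. by apply/rowP => k; rewrite !mxE mulr_natl cosD2pi sinD2pi. Qed.

Lemma unit_dir_arc s t w :
  sin w *: unit_dir t =
  sin (s + w - t) *: unit_dir s + sin (t - s) *: unit_dir (s + w).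
Proof.
have e1 : s + w - t = w - (t - s) by ring.
have e2 : t = s + (t - s) by ring.
(* In terms of [d = t - s], each coordinate is a polynomial identity after the addition formulas;
   expanding [t - s] itself would also require [cos ^+ 2 + sin ^+ 2 = 1]. *)
rewrite e1 {1}e2; move: (t - s) => d.
apply/rowP => k; rewrite !mxE; case: ifP => _.
  rewrite !cosD sinB; ring.
rewrite !sinD sinN cosN; ring.
Qed.

(** With [r] the norm, [acos (x / r)] has cosine [x / r]. Its sine is nonnegative, hence equal to
    [|y| / r], so this angle serves for [0 <= y] and its reflection [2 * pi - acos (x / r)] for
    [y < 0]. *)
Lemma polar_angle_exists v :
  v != 0 -> exists t, 0 <= t < 2 * pi /\ open_ray t v.
Proof.
move=> v_neq0; set x := v 0 0; set y := v 0 1.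
have vE r t : x = r * cos t -> y = r * sin t -> v = r *: unit_dir t.
  move=> xE yE; apply/rowP => k; rewrite !mxE.
  by case: k => [[|[|//]] lt_k] /=; rewrite -?xE -?yE; congr (v _ _);
    apply: val_inj.
have xy_gt0 : 0 < x ^+ 2 + y ^+ 2.
  rewrite lt_neqAle eq_sym paddr_eq0 ?sqr_ge0 // !sqrf_eq0.
  rewrite addr_ge0 ?sqr_ge0 // andbT.
  apply: contra v_neq0 => /andP[/eqP x0 /eqP y0].
  by rewrite (vE 0 0) ?scale0r // ?x0 ?y0 mul0r.
pose r := Num.sqrt (x ^+ 2 + y ^+ 2).
have r_gt0 : 0 < r by rewrite sqrtr_gt0.
have r2 : r ^+ 2 = x ^+ 2 + y ^+ 2 by rewrite sqr_sqrtr // ltW.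
have xr : -1 <= x / r <= 1.
  have : `|x| <= r by rewrite -sqrtr_sqr ler_wsqrtr // lerDl sqr_ge0.
  by rewrite ler_norml ler_pdivrMr // ler_pdivlMr // mulN1r mul1r.
have xE : x = r * cos (acos (x / r)).
  by rewrite acosK ?in_itv //= mulrC divfK // gt_eqF.
have yE : `|y| = r * sin (acos (x / r)).
  have sin_ge0 : 0 <= sin (acos (x / r)).
    by rewrite sin_ge0_pi // acos_ge0 //= acos_lepi.
  apply/eqP; rewrite -(eqrXn2 (n := 2)) ?mulr_ge0 ?(ltW r_gt0) //.
  rewrite real_normK ?num_real // exprMn sin2cos2 mulrBr mulr1 -exprMn -xE r2.
  by rewrite addrAC subrr add0r.
have [y_ge0|y_lt0] := leP 0 y.
  exists (acos (x / r)); split.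
    rewrite acos_ge0 //= (le_lt_trans (acos_lepi xr)) //.
    by have := pi_gt0 R; lra.
  by exists r => //; apply/esym/vE => //; rewrite -yE ger0_norm.
exists (2 * pi - acos (x / r)); split.
  (* Needed for the strict bound below [2 * pi]: a zero angle would force [y = 0]. *)
  have acos_gt0 : 0 < acos (x / r).
    rewrite lt_neqAle acos_ge0 // andbT; apply/eqP => acos0.
    move: yE; rewrite -acos0 sin0 mulr0 => /normr0P/eqP y0.
    by rewrite y0 ltxx in y_lt0.
  by have := acos_lepi xr; have := pi_gt0 R; lra.
exists r => //; apply/esym/vE.
  by rewrite {1}xE -cosN -(cosD2pi (- _)) addrC mulr_natl.
by rewrite addrC mulr_natl sinD2pi sinN mulrN -yE ltr0_norm ?opprK.
Qed.

Lemma polar_angleP v :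
  v != 0 -> 0 <= polar_angle v < 2 * pi /\ open_ray (polar_angle v) v.
Proof. by move=> /polar_angle_exists; exact: xgetPex. Qed.

Lemma open_ray_scale t u v :
  open_ray t u -> open_ray t v -> exists2 r, 0 <= r & v = r *: u.
Proof.
move=> [r r_gt0 <-] [r' r'_gt0 <-]; exists (r' / r).
  by rewrite divr_ge0 // ltW.
by rewrite scalerA divfK // gt_eqF.
Qed.

Lemma arc_sector_cone s w u v x : w < pi ->
  open_ray s u -> open_ray (s + w) v -> arc_sector s w x -> cone [:: v; u] x.
Proof.
move=> w_lt_pi su swv [t /andP[st tsw] tx].
have u_cone : cone [:: v; u] u by apply: mem_cone; rewrite !inE eqxx orbT.
have v_cone : cone [:: v; u] v by apply: mem_cone; rewrite !inE eqxx.
(* For [w <= 0] the arc has at most the one direction [s], and [sin w] may vanish. *)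
have [w_gt0|w_le0] := ltP 0 w; last first.
  have ts : t = s by lra.
  rewrite ts in tx; have [r r_ge0 ->] := open_ray_scale su tx.
  exact: coneZ.
have sinw_gt0 : 0 < sin w by apply: sin_gt0_pi; rewrite w_gt0.
have unit_cone t' z : open_ray t' z -> cone [:: v; u] z ->
    cone [:: v; u] (unit_dir t').
  move=> [r r_gt0 <-] /(coneZ (ltW (etrans (invr_gt0 r) r_gt0))).
  by rewrite scalerA mulVf ?scale1r // gt_eqF.
have [r r_gt0 <-] := tx; apply: coneZ (ltW r_gt0) _.
(* Insert [1 = (sin w)^-1 * sin w] to reach the form of [unit_dir_arc]; both of its sines are taken
   at angles in [[0, w]], hence are nonnegative. *)
rewrite -[unit_dir t]scale1r -(mulVf (lt0r_neq0 sinw_gt0)) -scalerA.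
rewrite (unit_dir_arc s); apply: coneZ; first by rewrite invr_ge0 ltW.
apply: coneD; apply: coneZ.
- by apply: sin_ge0_pi; lra.
- exact: unit_cone su _.
- by apply: sin_ge0_pi; lra.
- exact: unit_cone swv _.
Qed.

Variables (J : finType) (a : J -> 'rV[R]_2).
Let th := sorted_angles a.

Lemma mem_sorted_angles t :
  reflect (exists j, t = polar_angle (a j)) (t \in sorted_angles a).
Proof. by rewrite mem_sort; exact: codomP. Qed.

Lemma sorted_angles_le k l :
  (k <= l)%N -> (l < size th)%N -> th`_k <= th`_l.
Proof.
move=> kl l_lt; apply: (sorted_leq_nth le_trans) => //.
- exact/sort_sorted/le_total.
- by rewrite inE (leq_ltn_trans kl).
Qed.

(** The iterated maximum is either its starting value 0 or one of the gaps; positivity excludes the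
    former. *)
Lemma largest_gap_attained :
  0 < largest_gap a -> exists l : 'I_(size th), gap th l = largest_gap a.
Proof.
rewrite /largest_gap -/th; set G := bigop _ _ _ => G_gt0.
have : G = 0 \/ exists l : 'I_(size th), gap th l = G.
  rewrite /G; elim/big_ind: _ => [|x y Px Py|l _]; first by left.
    by rewrite /Order.max; case: ifP.
  by right; exists l.
by case=> // G0; rewrite G0 ltxx in G_gt0.
Qed.

Hypothesis a_neq0 : forall j, a j != 0.

Lemma sorted_angles_bound k : (k < size th)%N -> 0 <= th`_k < 2 * pi.
Proof.
move=> k_lt; have /mem_sorted_angles[j ->] := mem_nth 0 k_lt.
by have [] := polar_angleP (a_neq0 j).
Qed.

(* A gap runs from [th`_l] to its cyclic successor, so going around the rest of
   the circle leads back to [th`_l], after crossing the angle 0 unless the gap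
   is the wrap-around one. *)
Lemma gap_complement_end (l : 'I_(size th)) v : open_ray th`_l v ->
  open_ray (th`_(l.+1 %% size th) + (2 * pi - gap th l)) v.
Proof.
rewrite /gap; case: ltnP => [l1|l1] [r r_gt0 rE].
  rewrite modn_small //; exists r => //.
  have -> : th`_l.+1 + (2 * pi - (th`_l.+1 - th`_l)) = th`_l + 2 * pi by ring.
  by rewrite unit_dirD2pi.
have lE : l.+1 = size th by apply/eqP; rewrite eqn_leq l1 ltn_ord.
have lE' : (size th).-1 = l by have := congr1 predn lE.
rewrite {1}lE modnn lE' /=; exists r => //.
by have -> : th`_0 + (2 * pi - (th`_0 + 2 * pi - th`_l)) = th`_l by ring.
Qed.

Lemma gap_complement_sector (l : 'I_(size th)) j :
  arc_sector th`_(l.+1 %% size th) (2 * pi - gap th l) (a j).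
Proof.
have : polar_angle (a j) \in th by apply/mem_sorted_angles; exists j.
move=> /(nthP 0)[k k_lt kE].
have [_] := polar_angleP (a_neq0 j); rewrite -kE => -[r r_gt0 rE].
have kb := sorted_angles_bound k_lt.
have lb := sorted_angles_bound (ltn_ord l).
rewrite /gap; case: ltnP => [l1|l1].
  have l1b := sorted_angles_bound l1.
  rewrite modn_small //; have [kl|lk] := leqP k l.
    exists (th`_k + 2 * pi); last by exists r; rewrite ?unit_dirD2pi.
    by have := sorted_angles_le kl (ltn_ord l); lra.
  exists th`_k; last by exists r.
  by have := sorted_angles_le lk k_lt; lra.
have lE : l.+1 = size th by apply/eqP; rewrite eqn_leq l1 ltn_ord.
have lE' : (size th).-1 = l by have := congr1 predn lE.
rewrite {1}lE modnn lE' /=; exists th`_k; last by exists r.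
have kl : (k <= l)%N by rewrite -ltnS lE.
have := sorted_angles_le kl (ltn_ord l).
by have := sorted_angles_le (leq0n k) k_lt; lra.
Qed.

End Angles.

Theorem mainTheorem4 (R : realType) (J : finType) (a : J -> 'rV[R]_2)
    (J_nonempty : (0 < #|J|)%N)
    (a_neq0 : forall j, a j != 0)
    (G_gt_pi : pi < largest_gap a) :
  [/\ 2 * pi - largest_gap a < pi,
      exists j1 j2, adjacent_to_largest_gap a j1 j2
    & forall j1 j2, adjacent_to_largest_gap a j1 j2 ->
      [/\ forall j,
            arc_sector (polar_angle (a j2)) (2 * pi - largest_gap a) (a j),
          open_ray (polar_angle (a j2)) (a j2),
          open_ray (polar_angle (a j2) + (2 * pi - largest_gap a)) (a j1),
          cone [seq a j | j : J] = cone [:: a j1; a j2]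
        & forall j, cone [:: a j1; a j2] (a j)]].
Proof.
have w_lt_pi : 2 * pi - largest_gap a < pi by lra.
split=> //.
  have [l lG] := largest_gap_attained (lt_trans (pi_gt0 R) G_gt_pi).
  have th_gt0 := leq_ltn_trans (leq0n l) (ltn_ord l).
  have /mem_sorted_angles[j1 j1E] := mem_nth 0 (ltn_ord l).
  have /mem_sorted_angles[j2 j2E] := mem_nth 0 (ltn_pmod l.+1 th_gt0).
  by exists j1, j2, l.
move=> j1 j2 [l [lG j1E j2E]].
have sector j :
    arc_sector (polar_angle (a j2)) (2 * pi - largest_gap a) (a j).
  by rewrite j2E -lG; exact: gap_complement_sector.
have [_ ray2] := polar_angleP (a_neq0 j2).
(* Counterclockwise, the complementary arc runs from the end of the gap, [a j2], to its start,
   [a j1]. *)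
have ray1 : open_ray (polar_angle (a j2) + (2 * pi - largest_gap a)) (a j1).
  rewrite j2E -lG; apply: gap_complement_end; rewrite -j1E.
  by have [] := polar_angleP (a_neq0 j1).
have a_cone j : cone [:: a j1; a j2] (a j) by exact: arc_sector_cone (sector j).
split=> //; apply/seteqP; split; apply: cone_sub => v.
  by move=> /codomP[j ->].
by rewrite !inE => /orP[] /eqP ->; apply: mem_cone; exact: codom_f.
Qed.
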